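(* Let $p(x)$ be a real polynomial of degree $n$ having only real zeros, and suppose that its mesh size satisfies $\mu(p)\ge 1$. Then for all $x\in\mathbb{R}$, $$(n-1)\,[p(x+1)-p(x-1)]^2 - 4n\,p(x)\,[p(x+1)-2p(x)+p(x-1)] \ge 0 .$$
   Context: For a real polynomial $p$ of degree $n$ with only real zeros $\alpha_1\le\alpha_2\le\cdots\le\alpha_n$, repeated according to multiplicity, the mesh size is $\mu(p):=\min_{1\le k\le n-1}|\alpha_{k+1}-\alpha_k|$. (In particular $\mu(p)\ge 1$ forces the zeros to be simple.) When $n\le 1$ the minimum is over the empty set and the condition $\mu(p)\ge 1$ is regarded as vacuously satisfied. *)

(* Defs.v *)
From HB Require Import structures.
From mathcomp Require Import all_boot all_order all_algebra.
From mathcomp Require Import classical_sets reals constructive_ereal.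
From mathcomp Require Import complex polyorder polyrcf.

Set Implicit Arguments.
Unset Strict Implicit.
Unset Printing Implicit Defensive.

Import Order.TTheory GRing.Theory Num.Theory.

Local Open Scope ring_scope.

Definition only_real_zeros (R : realType) (p : {poly R}) : Prop :=
  forall z : R[i], root (map_poly (real_complex R) p) z -> complex.Im z = 0.

(* [rootsR p] lists the distinct real zeros of [p] in increasing order, so this
   is the list alpha_1 <= ... <= alpha_n of the real zeros of [p], each repeated
   according to its multiplicity. *)
Definition zeros (R : realType) (p : {poly R}) : seq R :=
  flatten [seq nseq (\mu_a p) a | a <- rootsR p].

(* The minimum is taken in the extended reals, so that it is +oo when [p] has
   at most one zero. *)
Definition mesh (R : realType) (p : {poly R}) : \bar R :=
  \big[Order.min/+oo%E]_(k < (size (zeros p)).-1)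
    `|(zeros p)`_k.+1 - (zeros p)`_k|%:E.

(* Main.v *)
Require Import Defs.
From HB Require Import structures.
From mathcomp Require Import all_boot all_order all_algebra.
From mathcomp Require Import classical_sets reals constructive_ereal.
From mathcomp Require Import complex polyorder polyrcf.
From mathcomp Require Import ring lra.

(* Write A, B, C for the values of p at x + 1, x, x - 1.  If AB <= 0 or
   CB <= 0, the inequality is a matter of signs and discriminants.  Otherwise
   p takes values of the same sign at both ends of [x - 1, x] and of
   [x, x + 1]; as the zeros are 1-separated, each of these intervals contains
   at most one zero, hence none.  So all y = 1 / (x - alpha) have |y| < 1, and
   dividing by B^2 one must show
     4 n (a + c - 2) <= (n - 1) (a - c)^2
   for a = prod (1 + y) and c = prod (1 - y).  This holds for arbitrary
   y in (-1, 1), by induction on n. *)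

Import Order.TTheory GRing.Theory Num.Theory.

Local Open Scope ring_scope.

(* Inductive step, with T = (a + c) / 2 and O = (a - c) / 2: adding a factor
   with y = z turns (T, O) into (T + z O, O + z T), and the difference of the
   two sides
   is a quadratic in z whose discriminant is controlled by [disc]. *)
Lemma laguerre_step (R : realFieldType) (n T O z : R) :
  1 <= n -> 0 < T -> 0 <= T ^+ 2 - O ^+ 2 <= 1 ->
  2 * n * (T - 1) <= (n - 1) * O ^+ 2 ->
  2 * (n + 1) * (T + z * O - 1) <= n * (O + z * T) ^+ 2.
Proof.
move=> n1 T0 /andP[G0 G1] IH.
have O2 : 0 <= O ^+ 2 by exact: sqr_ge0.
have disc : 2 * n * T ^+ 2 * (T - 1) <= O ^+ 2 * (2 * n * T - n - 1).
  (* For T <= 1 the right side minus the left is 2n(1 - T)(T^2 - O^2) + (n - 1) O^2. *)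
  have [T1|T1] := leP T 1.
    have : 0 <= (1 - T) * (T ^+ 2 - O ^+ 2) by apply: mulr_ge0 => //; lra.
    have : 0 <= (n - 1) * O ^+ 2 by apply: mulr_ge0 => //; lra.
    move=> h1 h2.
    have h3 : 0 <= n * ((1 - T) * (T ^+ 2 - O ^+ 2)) by apply: mulr_ge0 => //; lra.
    by nra.
  (* Now 2nT - n - 1 > 0, so a lower bound on O^2 suffices. For n > 1 the induction hypothesis gives
     2n(T - 1)/(n - 1), while T^2 - O^2 <= 1 gives T^2 - 1; the first is at least as good exactly
     when (n - 1)T <= n + 1. *)
  have [Tn|Tn] := leP ((n - 1) * T) (n + 1).
    have n1' : 0 < n - 1 \/ n = 1.
      by have [->|?] := eqVneq n 1; [right | left; rewrite subr_gt0 lt_neqAle eq_sym; apply/andP].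
    case: n1' => [n1'|n1']; last by rewrite n1' in IH *; nra.
    rewrite -(ler_pM2l n1').
    have h1 : 0 <= (2 * n * T - n - 1) * ((n - 1) * O ^+ 2 - 2 * n * (T - 1)).
      by apply: mulr_ge0; nra.
    have h2 : 0 <= 2 * n * (T - 1) * ((T - 1) * (n + 1 - (n - 1) * T)).
      by rewrite !mulr_ge0 //; lra.
    by nra.
  have h1 : 0 <= (2 * n * T - n - 1) * (O ^+ 2 - (T ^+ 2 - 1)).
    by apply: mulr_ge0; nra.
  have h2 : 0 <= (T - 1) * ((n - 1) * T - (n + 1)) by apply: mulr_ge0; lra.
  by nra.
have nT : 0 < n * T ^+ 2 by rewrite mulr_gt0 ?exprn_gt0 //; lra.
(* Multiplying by the leading coefficient n T^2 completes the square in z. *)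
rewrite -subr_ge0 -(pmulr_rge0 _ nT).
rewrite (_ : _ * (_ - _) = (n * T ^+ 2 * z + (n * T - (n + 1)) * O) ^+ 2 +
  (n + 1) * (O ^+ 2 * (2 * n * T - n - 1) - 2 * n * T ^+ 2 * (T - 1))); last by ring.
by rewrite addr_ge0 ?sqr_ge0 // mulr_ge0 ?subr_ge0 //; lra.
Qed.

(** Since T^2 - O^2 = ac, the inductive step needs the positivity of a and c and ac <= 1, which are
    therefore carried along. The list is nonempty because that step requires n >= 1. *)
Lemma laguerre_prod (R : realFieldType) (y : R) (s : seq R) :
  all (fun y => `|y| < 1) (y :: s) ->
  let a := \prod_(y <- y :: s) (1 + y) in
  let c := \prod_(y <- y :: s) (1 - y) in
  [/\ 0 < a, 0 < c, a * c <= 1 &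
    4 * (size (y :: s))%:R * (a + c - 2) <= ((size (y :: s))%:R - 1) * (a - c) ^+ 2].
Proof.
elim: s y => [|z s IH] y.
  rewrite /= andbT ltr_norml !big_seq1 => /andP[y1 y2].
  by split; [lra|lra|nra|lra].
move=> /= /andP[+ /IH]; rewrite ltr_norml => /andP[y1 y2] /= {IH}.
rewrite ![\prod_(_ <- y :: _) _]big_cons.
set a := \prod_(_ <- _) _; set c := \prod_(_ <- _) _.
have := ler0n R (size s); rewrite -![(size s).+2%:R]natr1 -!natr1.
set m := (size s)%:R => m0 [a0 c0 ac1 IH].
have ac0 : 0 < a * c by exact: mulr_gt0.
split; [by rewrite mulr_gt0 //; lra|by rewrite mulr_gt0 //; lra| |].
  rewrite mulrACA (_ : _ * (1 - y) = 1 - y ^+ 2); last by ring.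
  have : 0 <= y ^+ 2 by exact: sqr_ge0.
  by nra.
have := @laguerre_step R (m + 1) ((a + c) / 2) ((a - c) / 2) y.
have -> : ((a + c) / 2) ^+ 2 - ((a - c) / 2) ^+ 2 = a * c by field.
rewrite (ltW ac0) ac1 => /(_ _ _ isT) step.
have : 2 * (m + 1) * ((a + c) / 2 - 1) <= (m + 1 - 1) * ((a - c) / 2) ^+ 2 by lra.
move/step => {}step; have {}step := step _ _; lra.
Qed.

(** If some b lay in [u, v], the earlier entries would be at most u and the later ones at least v.
    Their factors would be nonnegative and that of b nonpositive, against the sign of the
    product. *)
Lemma outside_unit_gap (R : realFieldType) (s : seq R) (u v : R) :
  pairwise (fun a b => a + 1 <= b) s -> u < v -> v <= u + 1 ->
  0 < \prod_(b <- s) ((u - b) * (v - b)) ->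
  forall b, b \in s -> b < u \/ v < b.
Proof.
move=> sep uv vu + b bs; case/splitPr: bs sep => s1 s2.
rewrite pairwise_cat allrel_consr /= => /and3P[/andP[/allP s1b _] _ /andP[/allP bs2 _]].
rewrite big_cat big_cons /= => pos.
have [bu|ub] := ltP b u; first by left.
have [vb|bv] := ltP v b; first by right.
have h1 : 0 <= \prod_(c <- s1) ((u - c) * (v - c)).
  by rewrite big_seq prodr_ge0 // => c /s1b cb; rewrite mulr_ge0 //; lra.
have h2 : 0 <= \prod_(c <- s2) ((u - c) * (v - c)).
  by rewrite big_seq prodr_ge0 // => c /bs2 cb; rewrite mulr_le0 //; lra.
have hb : (u - b) * (v - b) <= 0 by rewrite mulr_le0_ge0 //; lra.
suff : \prod_(c <- s1) ((u - c) * (v - c)) *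
    ((u - b) * (v - b) * \prod_(c <- s2) ((u - c) * (v - c))) <= 0.
  by rewrite leNgt pos.
by rewrite mulr_ge0_le0 // mulr_le0_ge0.
Qed.

Lemma laguerre_opposite (R : realFieldType) (n A B C : R) : 2 <= n ->
  (A * B <= 0) || (C * B <= 0) ->
  0 <= (n - 1) * (A - C) ^+ 2 - 4 * n * B * (A - 2 * B + C).
Proof.
move=> n2.
wlog AB : A C / A * B <= 0 => [hw|_].
  case/orP => h; first by apply: hw; rewrite ?h.
  rewrite -sqrrN opprB (_ : A - 2 * B + C = C - 2 * B + A); last by ring.
  by apply: hw; rewrite ?h.
have B2 : 0 <= B ^+ 2 by exact: sqr_ge0.
have [CB|CB] := leP (C * B) 0.
  have : 0 <= (n - 1) * (A - C) ^+ 2 by rewrite mulr_ge0 ?sqr_ge0 //; lra.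
  have : 0 <= n * (2 * B ^+ 2 - A * B - C * B) by rewrite mulr_ge0 //; lra.
  by lra.
(* B^2 (AC) = (AB)(CB) <= 0. *)
have AC : A * C <= 0.
  have B0 : 0 < B ^+ 2.
    rewrite lt_neqAle B2 eq_sym sqrf_eq0 andbT.
    by apply: contraTneq CB => ->; rewrite mulr0 ltxx.
  by rewrite -(pmulr_lle0 _ B0); nra.
(* Complete the square in B after writing (A - C)^2 = (A + C)^2 - 4AC; the remaining coefficient (n
   - 2)/2 is where n >= 2 enters. *)
rewrite (_ : _ - 4 * n * B * _ = (n - 2) * (A + C) ^+ 2 / 2 +
  n / 2 * (A + C - 4 * B) ^+ 2 - 4 * (n - 1) * (A * C));
  last by field.
have : 0 <= (n - 2) * (A + C) ^+ 2 by rewrite mulr_ge0 ?sqr_ge0 //; lra.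
have : 0 <= n * (A + C - 4 * B) ^+ 2 by rewrite mulr_ge0 ?sqr_ge0 //; lra.
have : 0 <= (n - 1) * (- (A * C)) by rewrite mulr_ge0 //; lra.
by lra.
Qed.

Lemma laguerre_separated (R : realFieldType) (s : seq R) (x : R) :
  pairwise (fun a b => a + 1 <= b) s ->
  let n : R := (size s)%:R in
  let q t := \prod_(b <- s) (t - b) in
  is_true (0 <= (n - 1) * (q (x + 1) - q (x - 1)) ^+ 2
                - 4 * n * q x * (q (x + 1) - 2 * q x + q (x - 1))).
Proof.
move=> sep n q.
have [s0|sn0] := eqVneq s [::]; first by rewrite /q /n s0 !big_nil /=; lra.
(* With a single zero, both n - 1 and the second difference vanish. *)
have [s1|s_ge2] := leqP (size s) 1.
  case: s sep sn0 s1 @n @q => [|b [|]] // _ _ _ n q.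
  by rewrite /q /n !big_seq1 /=; nra.
have [opp|] := boolP ((q (x + 1) * q x <= 0) || (q (x - 1) * q x <= 0)).
  by apply: laguerre_opposite opp; rewrite ler_nat.
rewrite negb_or -!ltNge => /andP[AB CB].
have far b : b \in s -> 1 < `|x - b|.
  move=> bs.
  have : b < x \/ x + 1 < b.
    by apply: outside_unit_gap bs => //; rewrite ?big_split /= 1?mulrC //; lra.
  have : b < x - 1 \/ x < b.
    by apply: outside_unit_gap bs => //; rewrite ?big_split //=; lra.
  by rewrite ltr_normr; case=> ?; case=> ?; lra.
have xb0 b : b \in s -> x - b != 0.
  by move=> /far; apply: contraTneq => ->; rewrite normr0 ltr10.
set ys := [seq (x - b)^-1 | b <- s].
have qa : q (x + 1) = q x * \prod_(y <- ys) (1 + y).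
  rewrite /q big_map -big_split !big_seq /=; apply: eq_bigr => b /xb0 b0; field; exact: b0.
have qc : q (x - 1) = q x * \prod_(y <- ys) (1 - y).
  rewrite /q big_map -big_split !big_seq /=; apply: eq_bigr => b /xb0 b0; field; exact: b0.
have ys1 : all (fun y => `|y| < 1) ys.
  apply/allP => _ /mapP[b bs ->]; rewrite normfV invf_lt1 ?far // normr_gt0; exact: xb0.
have nys : n = (size ys)%:R by rewrite size_map.
rewrite qa qc nys; case: ys nys ys1 {qa qc} => [|y ys] nys ys1.
  by move: sn0; move/eqP: nys; rewrite /n eqr_nat size_eq0 => ->.
have [_ _ _] := laguerre_prod _ _ _ ys1.
move: (\prod_(_ <- _) _) (\prod_(_ <- _) _) => c a ineq.
have : 0 <= q x ^+ 2 *
    (((size (y :: ys))%:R - 1) * (a - c) ^+ 2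
     - 4 * (size (y :: ys))%:R * (a + c - 2)).
  by rewrite mulr_ge0 ?sqr_ge0 // subr_ge0.
by lra.
Qed.

(** Over [R[i]] the polynomial splits; its roots equal their real parts, and the factorization
    descends because mapping coefficients is injective. *)
Lemma only_real_zeros_split (R : realType) (p : {poly R}) :
  only_real_zeros p -> exists s, p = lead_coef p *: \prod_(a <- s) ('X - a%:P).
Proof.
move=> realp; have [->|p0] := eqVneq p 0.
  by exists [::]; rewrite lead_coef0 scale0r.
set f := real_complex R.
have [r pr] := closed_field_poly_normal (map_poly f p).
have lp0 : f (lead_coef p) != 0 by rewrite fmorph_eq0 lead_coef_eq0.
exists [seq complex.Re z | z <- r]; apply: (map_poly_inj f).
rewrite {1}pr lead_coef_map map_polyZ rmorph_prod big_map /= big_seq [in RHS]big_seq.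
congr (_ *: _); apply: eq_bigr => z zr; rewrite map_polyXsubC /=; congr ('X - _%:P).
have /realp : root (map_poly f p) z.
  by rewrite pr lead_coef_map rootZ // root_prod_XsubC.
by case: z {zr} => a b /= ->.
Qed.

Lemma mu_prod_XsubC (R : idomainType) (s : seq R) (a : R) :
  \mu_a (\prod_(b <- s) ('X - b%:P)) = count_mem a s.
Proof.
elim: s => [|b s IH]; first by rewrite big_nil muNroot // root1.
rewrite big_cons mu_mul; last by rewrite mulf_neq0 ?polyXsubC_eq0 // monic_neq0 // monic_prod_XsubC.
rewrite IH /=; congr (_ + _)%N; have [->|ba] := eqVneq; first exact: mu_XsubC.
by rewrite muNroot // root_XsubC eq_sym.
Qed.

(** The multiplicity of a in p is its number of occurrences in s, so [zeros p] is s with equal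
    entries grouped. *)
Lemma perm_zeros (R : realType) (p : {poly R}) (s : seq R) :
  p != 0 -> p = lead_coef p *: \prod_(a <- s) ('X - a%:P) -> perm_eq (zeros p) s.
Proof.
move=> p0 ps; rewrite /zeros.
have mup a : \mu_a p = count_mem a s.
  rewrite ps -mul_polyC mu_mul ?mul_polyC -?ps // mu_polyC mu_prod_XsubC //.
rewrite (eq_map (g := fun a => nseq (count_mem a s) a)); last by move=> a; rewrite mup.
apply: perm_trans (perm_count_undup s).
apply/perm_flatten/perm_map/uniq_perm; rewrite ?undup_uniq ?uniq_roots // => a.
have lp0 : lead_coef p != 0 by rewrite lead_coef_eq0.
by rewrite mem_undup -(roots_on_rootsR p0) {1}ps rootZ // root_prod_XsubC itv_boundlr.
Qed.

Lemma sorted_zeros (R : realType) (p : {poly R}) : sorted <=%R (zeros p).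
Proof.
rewrite le_sorted_pairwise /zeros.
have : pairwise <%R (rootsR p) by rewrite -lt_sorted_pairwise sorted_roots.
elim: (rootsR p) => //= a s IH /andP[/allP as_ /IH{}IH].
rewrite pairwise_cat IH andbT; apply/andP; split.
  apply/allrelP => b c; rewrite mem_nseq => /andP[_ /eqP->] /flattenP[t /mapP[d ds ->]].
  by rewrite mem_nseq => /andP[_ /eqP->]; exact/ltW/as_.
by elim: (\mu_a p) => //= k ->; rewrite andbT; apply/allP => b; rewrite mem_nseq => /andP[_ /eqP->].
Qed.

(** Sortedness removes the absolute values, and transitivity of a + 1 <= b extends the gap from
    neighbours to all pairs. *)
Lemma mesh_ge1_separated (R : realType) (p : {poly R}) :
  (1 <= mesh p)%E -> pairwise (fun a b => a + 1 <= b) (zeros p).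
Proof.
rewrite /mesh => /bigmin_geP[_ gap].
rewrite -sorted_pairwise; last by move=> b a c; lra.
apply/(sortedP 0) => i isz.
have il : (i < (size (zeros p)).-1)%N by rewrite -ltnS prednK // (leq_trans _ isz).
have /(_ isT) := gap (Ordinal il); rewrite lee_fin /= ger0_norm; first lra.
by rewrite subr_ge0; apply: (sortedP 0 _) isz; exact: sorted_zeros.
Qed.

Theorem theorem2p17 (R : realType) (n : nat) (p : {poly R})
    (degp : size p = n.+1) (realp : only_real_zeros p)
    (meshp : (1 <= mesh p)%E) (x : R) :
  0 <= (n%:R - 1) * (p.[x + 1] - p.[x - 1]) ^+ 2
       - 4 * n%:R * p.[x] * (p.[x + 1] - 2 * p.[x] + p.[x - 1]).
Proof.
have p0 : p != 0 by rewrite -size_poly_eq0 degp.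
have [s ps] := only_real_zeros_split _ _ realp.
have zs := perm_zeros _ _ _ p0 ps.
have nz : n = size (zeros p).
  rewrite (perm_size zs); apply: succn_inj; rewrite -degp ps.
  by rewrite size_scale ?lead_coef_eq0 // size_prod_XsubC.
have pE t : p.[t] = lead_coef p * \prod_(b <- zeros p) (t - b).
  rewrite {1}ps hornerZ horner_prod (perm_big _ zs) /=; congr (_ * _).
  by apply: eq_bigr => b _; rewrite hornerXsubC.
have /= := laguerre_separated _ _ x (mesh_ge1_separated _ _ meshp).
(* The expression is quadratic in p, so the leading coefficient comes out as a square. *)
rewrite -nz !pE => /(mulr_ge0 (sqr_ge0 (lead_coef p))).
by lra.
Qed.
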